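(* Let $t>0$ and $\kappa\in(-1,1)$ with $\kappa\neq0$. The probability measure $N_{\kappa,t}$ on the unit circle $\mathbb{T}$ is absolutely continuous with respect to Lebesgue measure on $\mathbb{T}$, and its density belongs to $L^\infty(\mathbb{T})$.
   Context: $\mathbb{D}$ is the open unit disc and all square roots are principal branches. Let $H_0(z)=\frac{1+z}{1-z}$; $\alpha(z)=\frac{1-\sqrt{1-z}}{1+\sqrt{1-z}}$ for $z\in\mathbb{C}\setminus[1,\infty)$, an analytic bijection onto $\mathbb{D}$ with inverse $\alpha^{-1}(z)=\frac{4z}{(1+z)^2}$ (this rational formula is used for $\alpha^{-1}(z)$ at every $z\in\mathbb{C}$, with value $\infty$ at $z=-1$); $a(y)=\sqrt{\kappa^2+(1-\kappa^2)y^2}$; $\xi_{2t}(u)=\frac{u-1}{u+1}e^{tu}$; and $$\psi_{\kappa,t}(z)=\alpha\left(\frac{a^2(y)}{a^2(y)-\kappa^2}\,\alpha^{-1}[\xi_{2t}(a(y))]\right),\qquad y=H_0(z),$$ at those $z\in\mathbb{D}$ for which the argument of $\alpha$ lies in $\mathbb{C}\setminus[1,\infty)$. Let $\Lambda_{\kappa,t}$ be the connected component containing $0$ of the set of such $z$. The map $\psi_{\kappa,t}$ is an analytic bijection from $\Lambda_{\kappa,t}$ onto $\mathbb{D}$, and $\psi_{\kappa,t}^{-1}:\mathbb{D}\to\Lambda_{\kappa,t}$ denotes its inverse. The measure $N_{\kappa,t}$ (the Aleksandrov–Clark measure of $\psi_{\kappa,t}^{-1}$ at the point $1$) is the unique probability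 measure on $\mathbb{T}$ such that $$H_0(\psi_{\kappa,t}^{-1}(z))=\int_{\mathbb{T}}\frac{w+z}{w-z}\,N_{\kappa,t}(dw),\qquad z\in\mathbb{D}.$$ *)

(* Defs.v *)
From HB Require Import structures.
From mathcomp Require Import all_boot all_order all_algebra.
From mathcomp Require Import complex.
From mathcomp Require Import all_classical all_reals all_analysis.
From mathcomp Require Import lra.

Set Implicit Arguments.
Unset Strict Implicit.
Unset Printing Implicit Defensive.

Import Order.TTheory GRing.Theory Num.Theory.
Import numFieldNormedType.Exports.

Local Open Scope classical_set_scope.
Local Open Scope ring_scope.
Local Open Scope complex_scope.

(* R[i] carries the topology of its modulus; norms and order comparisons of
   complex numbers are R[i]-valued: x <= y means that y - x is real and
   nonnegative. *)
HB.instance Definition _ (R : realType) := NormedModule.copy R[i] R[i]^o.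

Section Loewner_map.
Variable R : realType.
Implicit Types (t kappa : R) (u y z : R[i]).

Definition cexp z : R[i] :=
  let: x +i* y := z in (expR x * cos y) +i* (expR x * sin y).

Definition H0 z : R[i] := (1 + z) / (1 - z).

(* sqrtc is the principal branch (nonnegative real part, cut along the negative
   half-line), contrary to sqrtC, whose values have nonnegative imaginary
   part. *)
Definition alpha z : R[i] := (1 - sqrtc (1 - z)) / (1 + sqrtc (1 - z)).

(* The value at -1 is infinity; since x / 0 = 0 here, this point is excluded
   explicitly in psi_dom. *)
Definition alpha_inv z : R[i] := 4 * z / (1 + z) ^+ 2.

Definition a_ kappa y : R[i] :=
  sqrtc ((kappa ^+ 2)%:C + (1 - kappa ^+ 2)%:C * y ^+ 2).

(* xi t is the function written xi_{2t}. *)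
Definition xi t u : R[i] := (u - 1) / (u + 1) * cexp (t%:C * u).

Definition psi_arg kappa t z : R[i] :=
  let a := a_ kappa (H0 z) in
  a ^+ 2 / (a ^+ 2 - (kappa ^+ 2)%:C) * alpha_inv (xi t a).

Definition psi kappa t z : R[i] := alpha (psi_arg kappa t z).

(* When xi t a = -1 the argument of alpha is infinite, a being nonzero;
   ~~ (1 <= w) says that w lies off the half-line [1, +oo). *)
Definition psi_dom kappa t : set R[i] :=
  [set z | [/\ `|z| < 1, xi t (a_ kappa (H0 z)) != -1
             & ~~ (1 <= psi_arg kappa t z)]].

Definition Lambda kappa t : set R[i] :=
  connected_component (psi_dom kappa t) 0.

(* The inverse of psi on its image psi @` Lambda, which is the open unit disc;
   the default value 0 is only taken off that image. *)
Definition psi_inv kappa t : R[i] -> R[i] :=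
  'pinv_(fun=> 0) (Lambda kappa t) (psi kappa t).

End Loewner_map.

Section unit_circle.
Variable R : realType.

Definition circle : Type := set_type [set w : R[i] | `|w| = 1].

Lemma circle1 : (1 : R[i]) \in [set w : R[i] | `|w| = 1].
Proof. by rewrite inE /= normr1. Qed.

HB.instance Definition _ := Topological.on circle.
HB.instance Definition _ := isPointed.Build circle (exist _ 1 circle1).

Definition Borel_circle := g_sigma_algebraType (@open circle).
HB.instance Definition _ := Measurable.on Borel_circle.

Lemma expi_circle (x : R) :
  (cos x +i* sin x) \in [set w : R[i] | `|w| = 1].
Proof. by rewrite inE /= normc_def /= cos2Dsin2 sqrtr1. Qed.

Definition expi (x : measurableTypeR R) : Borel_circle :=
  exist (fun w => w \in [set w : R[i] | `|w| = 1]) _ (expi_circle x).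

Lemma continuous_cos_sin :
  continuous (fun x : R => (cos x +i* sin x : R[i])).
Proof.
move=> x; apply/cvgrPdist_lt => -[e e'].
rewrite ltcE /= => /andP[/eqP -> e0].
have e2 : 0 < e / 2 by rewrite divr_gt0.
have /cvgrPdist_lt/(_ _ e2) cx := @continuous_cos R x.
have /cvgrPdist_lt/(_ _ e2) sx := @continuous_sin R x.
near=> y.
have hc : `|cos x - cos y| < e / 2 by near: y; exact: cx.
have hs : `|sin x - sin y| < e / 2 by near: y; exact: sx.
rewrite normc_def /= ltcR -(@gtr0_norm _ e)// -sqrtr_sqr.
rewrite ltr_sqrt ?exprn_gt0// -(real_normK (num_real (cos x - cos y))).
rewrite -(real_normK (num_real (sin x - sin y))).
move: (normr_ge0 (cos x - cos y)) (normr_ge0 (sin x - sin y)).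
nra.
Unshelve. all: by end_near. Qed.

Lemma measurable_expi : measurable_fun setT expi.
Proof.
apply: (@measurability _ _ _ _ setT expi (@open circle)) => //.
move=> _ [_ [C oC <-] <-]; rewrite setTI -comp_preimage.
apply: measurable_realfun.open_measurable.
by apply: open_comp => // x _; exact: continuous_cos_sin.
Qed.

HB.instance Definition _ :=
  isMeasurableFun.Build _ _ _ _ expi measurable_expi.

(* Lebesgue measure on the circle, normalized to total mass 2 * pi. *)
Definition arc_length : set Borel_circle -> \bar R :=
  pushforward
    (mrestr (@lebesgue_measure R) (measurable_itv `[0%R, (2 * pi)%R[)) expi.

Let arc_length0 : arc_length set0 = 0%E.
Proof. exact: measure0. Qed.

Let arc_length_ge0 A : (0 <= arc_length A)%E.
Proof. exact: measure_ge0. Qed.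

Let arc_length_sigma_additive : semi_sigma_additive arc_length.
Proof. exact: measure_semi_sigma_additive. Qed.

HB.instance Definition _ := isMeasure.Build _ _ _ arc_length
  arc_length0 arc_length_ge0 arc_length_sigma_additive.

Definition cintegral (mu : {measure set Borel_circle -> \bar R})
    (f : Borel_circle -> R[i]) : R[i] :=
  (\int[mu]_w complex.Re (f w)) +i* (\int[mu]_w complex.Im (f w)).

Definition Herglotz (mu : {measure set Borel_circle -> \bar R}) (z : R[i]) :
    R[i] :=
  cintegral mu (fun w => (val w + z) / (val w - z)).

End unit_circle.

Arguments arc_length R : clear implicits.

Definition is_Clark_measure_at_1 (R : realType) (phi : R[i] -> R[i])
    (mu : probability (Borel_circle R) R) : Prop :=
  forall z : R[i], `|z| < 1 -> H0 (phi z) = Herglotz mu z.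

(* Main.v *)
Require Import Defs.
From HB Require Import structures.
From mathcomp Require Import all_boot all_order all_algebra.
From mathcomp Require Import complex.
From mathcomp Require Import all_classical all_reals all_analysis.
From mathcomp Require Import measurable_realfun ess_sup_inf.
From mathcomp Require Import ring lra.

(** The Clark measure of a self-map phi of the disc is an absolutely continuous
measure with bounded density as soon as Re (H0 o phi) is bounded above. Here
phi is the inverse of psi; its values lie in Lambda, or are the default 0, where
H0 is 1. So everything rests on a bound for Re (H0 z) with z in Lambda.

Why Re (H0 z) is bounded on Lambda. Put y = H0 z, a = a_ kappa y, and
  F = a (1 - xi) / (1 + xi) with xi = xi t a,  Y = y sqrt (1 - psi_arg z),
[riccati_end] and [loewner_end] below. The definition of psi_arg says exactly
that (1 - kappa^2) Y^2 = F^2 - kappa^2 ([loewner_riccati]), just as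
(1 - kappa^2) y^2 = a^2 - kappa^2. Hence F and Y determine each other up to
sign, and either they lie in the same quadrant or they lie in opposite ones.
The sign of the real number Re (Y conj F), called [side], records which case
occurs, and it is locally constant on the domain of psi:
- it is continuous there ([side_continuous]), since 1 - psi_arg avoids the
  cut of the square root and xi avoids -1;
- it does not vanish ([side_neq0]). It could only do so for real F. But F is
  minus the logarithmic derivative, at time t/2, of the solution u of
  u'' = a^2 u with u 0 = 1 and u' 0 = -1. As a function of a^2 this quotient
  is of Herglotz type, so a real value of F forces a^2, hence y, to be real
  ([Im_riccati_eq0]); then both Y and F are real and the relation above rules
  out F = 0.
At z = 0 we have y = Y = F = 1, so [side] is positive on the connected set
Lambda ([side_gt0]). When Re y is large, however, xi is huge, F is close to -a
and Y is close to y, so [side] is negative ([side_lt0]). Hence Re y is bounded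
on Lambda.

From the bound to the measure. Let C bound the Poisson integral of N, which is
Re (H0 o phi). At the point (1 - d) w0 the Poisson kernel is at least 1 / (2 d)
on the disc of radius d around w0, so this disc has N-mass at most 2 C d
([clark_disk]). Covering a Borel set by small arcs gives N <= 4 C arc_length
([clark_le_arc_length]), and such a bound turns into a density bounded by the
same constant through the Radon-Nikodym theorem ([bounded_density]). *)

Set Implicit Arguments.
Unset Strict Implicit.
Unset Printing Implicit Defensive.

Import Order.TTheory GRing.Theory Num.Theory.
Import numFieldNormedType.Exports.
Import Normc.

Local Open Scope classical_set_scope.
Local Open Scope ring_scope.

(** * Topology of the complex numbers *)

Section complex_topology.
Local Open Scope complex_scope.
Variable R : realType.
Implicit Types (z w : R[i]).
Local Notation Re := (@complex.Re R).
Local Notation Im := (@complex.Im R).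

#[local] Hint Extern 0 (Filter _) =>
  solve [apply: (@nbhs_filter R[i])] : typeclass_instances.

Lemma near_dist_lt z (e : R[i]) : 0 < e -> \forall w \near z, `|z - w| < e.
Proof.
have zz : id x @[x --> z] --> z by exact: cvg_id.
by move/cvgrPdist_lt : zz => /(_ e).
Qed.

Lemma Re_continuous : continuous Re.
Proof.
move=> z; apply/cvgrPdist_lt => e e0.
near=> w; have zw : `|z - w| < e%:C.
  by near: w; apply: near_dist_lt; rewrite ltcR.
by rewrite -raddfB -ltcR (le_lt_trans (normc_ge_Re _)).
Unshelve. all: by end_near. Qed.

Lemma real_complex_continuous : continuous (fun x : R => x%:C).
Proof.
move=> x; apply/cvgrPdist_lt => -[e e1]; rewrite ltcE /= => /andP[/eqP-> e0].
near=> y.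
rewrite -rmorphB normc_def /= expr0n addr0 sqrtr_sqr ltcR.
by near: y; exact: cvgr_dist_lt.
Unshelve. all: by end_near. Qed.

Lemma Im_continuous : continuous Im.
Proof.
have -> : Im = (fun z => - Re (z * 'i%C)) by apply/funext => z; rewrite ReiNIm opprK.
move=> z; apply: cvgN.
have zi : w * 'i%C @[w --> z] --> z * 'i%C by apply: cvgM; [exact: cvg_id|exact: cvg_cst].
exact: (cvg_comp _ _ zi (@Re_continuous _)).
Qed.

Lemma complex_cvg {T : Type} {F : set_system T} {FF : Filter F} (f g : T -> R) a b :
  f @ F --> a -> g @ F --> b -> (f x +i* g x) @[x --> F] --> (a +i* b).
Proof.
move=> fa gb.
have -> : (fun x => f x +i* g x) = (fun x => (f x)%:C + 'i%C * (g x)%:C).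
  by apply/funext => x; exact: (complexE (f x +i* g x)).
rewrite (complexE (a +i* b)); apply: cvgD; last apply: cvgM.
- exact: (cvg_comp _ _ fa (@real_complex_continuous _)).
- exact: cvg_cst.
- exact: (cvg_comp _ _ gb (@real_complex_continuous _)).
Qed.

Lemma cexp_continuous : continuous (@cexp R).
Proof.
have -> : @cexp R = fun z => (expR (Re z) * cos (Im z)) +i* (expR (Re z) * sin (Im z)).
  by apply/funext => -[].
move=> z; have er : expR (Re w) @[w --> z] --> expR (Re z).
  by apply: continuous_comp; [exact: Re_continuous|exact: continuous_expR].
apply: complex_cvg; apply: cvgM => //; apply: continuous_comp.
- exact: Im_continuous.
- exact: continuous_cos.
- exact: Im_continuous.
- exact: continuous_sin.
Qed.

Lemma Re_sqrtc_ge0 z : 0 <= Re (sqrtc z).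
Proof. by case: z => x y; exact: sqrtr_ge0. Qed.

Lemma Re_sqrtc_gt0 z : ~~ (z <= 0) -> 0 < Re (sqrtc z).
Proof.
rewrite lt_def Re_sqrtc_ge0 andbT; apply: contra => /eqP.
rewrite -{2}(sqr_sqrtc z); case: (sqrtc z) => x y /= ->.
rewrite lecE expr2 /= !mul0r mulr0 addr0 eqxx /= sub0r oppr_le0.
by rewrite -expr2 sqr_ge0.
Qed.

(** The cut of the principal root is the closed negative half-line. Off it,
|sqrt z - sqrt w| |sqrt z + sqrt w| = |z - w| and the sum of the roots has real
part at least Re (sqrt z) > 0, so the root is locally Lipschitz. *)
Lemma sqrtc_continuous z : ~~ (z <= 0) -> {for z, continuous (@sqrtc R)}.
Proof.
move=> /Re_sqrtc_gt0; set d := Re _ => d0.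
apply/cvgrPdist_lt => e e0.
near=> w.
have zw : `|z - w| < e * d%:C.
  near: w; apply: near_dist_lt.
  by rewrite mulr_gt0 ?ltcR.
rewrite -(@ltr_pM2r _ d%:C) ?ltcR//; apply: le_lt_trans zw.
rewrite -[in leRHS](sqr_sqrtc z) -[in leRHS](sqr_sqrtc w) subr_sqr normrM.
rewrite ler_wpM2l// (le_trans _ (normc_ge_Re _))// lecR raddfD /=.
by rewrite (le_trans _ (ler_norm _))// lerDl Re_sqrtc_ge0.
Unshelve. all: by end_near. Qed.

End complex_topology.

(** * Herglotz property of the Riccati solution *)

Section riccati.
Local Open Scope complex_scope.
Variable R : realType.
Implicit Types (x v s t : R).

(* The squared moduli of a - 1 and a + 1. *)
Let P x v : R := (x - 1) ^+ 2 + v ^+ 2.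
Let Q x v : R := (x + 1) ^+ 2 + v ^+ 2.

(** With a = x + i v, let u be the solution of u'' = a^2 u with u 0 = 1 and
u' 0 = -1. At time s / 2 this is 4 |a|^2 Im (conj u u'), written out with
2 a u = (a - 1) exp (a s / 2) + (a + 1) exp (- a s / 2). *)
Definition wronskian x v s : R :=
  v * (P x v * expR (x * s) - Q x v * expR (- (x * s)))
  + 2 * x * (x ^+ 2 + v ^+ 2 - 1) * sin (v * s) + 4 * x * v * cos (v * s).

(** The same expansion of 4 |a|^2 |u|^2 at time s / 2. *)
Definition sol_norm x v s : R :=
  P x v * expR (x * s) + Q x v * expR (- (x * s))
  + 2 * ((x ^+ 2 + v ^+ 2 - 1) * cos (v * s) - 2 * v * sin (v * s)).

(** As u'' = a^2 u, the derivative of Im (conj u u') is Im (a^2) |u|^2. Here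
Im (a^2) = 2 x v, and the time s / 2 contributes a factor 1 / 2. *)
Lemma is_derive_wronskian x v s : is_derive s 1 (wronskian x v) (x * v * sol_norm x v s).
Proof.
have dl (a : R) : is_derive s 1 (fun s => a * s) a.
  apply: (is_derive_eq (is_deriveZ a (is_derive_id s 1))).
  by rewrite /GRing.scale /= mulr1.
have dE a : is_derive s 1 (fun s => expR (a * s)) (a * expR (a * s)).
  have := @is_derive1_comp _ expR (fun s => a * s) s _ _ (is_derive_expR _) (dl a).
  by rewrite /GRing.scale /= mulrC.
have dE' : is_derive s 1 (fun s => expR (- (x * s))) (- x * expR (- (x * s))).
  have -> : (fun s => expR (- (x * s))) = (fun s => expR (- x * s)).
    by apply/funext => u; rewrite mulNr.
  by rewrite -mulNr; exact: dE.
have dS : is_derive s 1 (fun s => sin (v * s)) (v * cos (v * s)).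
  have := @is_derive1_comp _ sin (fun s => v * s) s _ _ (is_derive_sin _) (dl v).
  by rewrite /GRing.scale /= mulrC.
have dC : is_derive s 1 (fun s => cos (v * s)) (v * - sin (v * s)).
  have := @is_derive1_comp _ cos (fun s => v * s) s _ _ (is_derive_cos _) (dl v).
  by rewrite /GRing.scale /= mulrC.
rewrite /wronskian; apply: is_derive_eq.
rewrite /sol_norm /GRing.scale /=; ring.
Qed.

(** With p and q the two exponential terms of 2 a u, sol_norm is |p + q|^2 and
the second factor on the left is |p - q|^2; their product is
|p^2 - q^2|^2 = (|p|^2 - |q|^2)^2 + 4 (Im (p conj q))^2. *)
Lemma sol_norm_cofactor x v s : let E := expR (x * s) in
  let T := (x ^+ 2 + v ^+ 2 - 1) * cos (v * s) - 2 * v * sin (v * s) in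
  sol_norm x v s * (P x v * E + Q x v / E - 2 * T) =
  (P x v * E - Q x v / E) ^+ 2 +
  4 * ((x ^+ 2 + v ^+ 2 - 1) * sin (v * s) + 2 * v * cos (v * s)) ^+ 2.
Proof.
rewrite /sol_norm expRN /=; have := cos2Dsin2 (v * s); have := expR_gt0 (x * s).
move: (expR _) (cos _) (sin _) => E c d E0 cs.
set T := _ - 2 * v * d; set W := _ + 2 * v * c.
have PQ : P x v * Q x v = T ^+ 2 + W ^+ 2.
  rewrite /P /Q /T /W; transitivity ((c ^+ 2 + d ^+ 2) *
    ((x ^+ 2 + v ^+ 2 - 1) ^+ 2 + 4 * v ^+ 2)); last by ring.
  by rewrite cs; ring.
have -> : (P x v * E - Q x v / E) ^+ 2 =
    (P x v * E + Q x v / E) ^+ 2 - 4 * (P x v * Q x v).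
  by field; rewrite gt_eqF.
by rewrite PQ; ring.
Qed.

Lemma sol_norm_ge0 x v s : 0 <= sol_norm x v s.
Proof.
have := sol_norm_cofactor x v s; rewrite /sol_norm expRN /=.
set S := P x v * _ + _; set T := (_ - 2 * v * _) => ST.
have S0 : 0 <= S.
  by rewrite addr_ge0// mulr_ge0 ?invr_ge0 ?expR_ge0// addr_ge0 ?sqr_ge0.
have : 0 <= (S + 2 * T) * (S - 2 * T).
  by rewrite ST addr_ge0 ?sqr_ge0// mulr_ge0 ?sqr_ge0.
by rewrite leNgt => h; rewrite leNgt; apply/negP => T0; move: h => /negP; apply; nra.
Qed.

Lemma sol_norm_eq0 x v s : sol_norm x v s = 0 -> P x v * expR (x * s) ^+ 2 = Q x v.
Proof.
have := sol_norm_cofactor x v s => /= + w0; rewrite w0 mul0r.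
have := expR_gt0 (x * s); move: (expR _) => E E0 /esym/eqP.
rewrite paddr_eq0 ?sqr_ge0 ?(mulr_ge0 _ (sqr_ge0 _))// => /andP[+ _].
rewrite sqrf_eq0 subr_eq0 => /eqP PE.
by rewrite expr2 mulrA PE divfK// gt_eqF.
Qed.

(** The wronskian starts at 0 and has a derivative of constant sign. If it
vanished at t, the mean value theorem on both halves of [0, t] would give two
distinct zeros of |u|^2. But at a zero of u the two exponential parts have equal
moduli, which happens at one time only. *)
Lemma wronskian_neq0 x v t : 0 < x -> v != 0 -> 0 < t -> wronskian x v t != 0.
Proof.
move=> x0 v0 t0; apply/eqP => wt.
have w0 : wronskian x v 0 = 0.
  by rewrite /wronskian !mulr0 oppr0 expR0 sin0 cos0 /P /Q; ring.
have wc a b : {within `[a, b], continuous (wronskian x v)}.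
  apply: continuous_subspaceT => s.
  apply/differentiable_continuous/derivable1_diffP.
  by have [] := is_derive_wronskian x v s.
have h0 : 0 < t / 2 by lra.
have ht : t / 2 < t by lra.
have [c1 + e1] := MVT h0 (fun s _ => is_derive_wronskian x v s) (wc _ _).
have [c2 + e2] := MVT ht (fun s _ => is_derive_wronskian x v s) (wc _ _).
rewrite !in_itv /= => /andP[c2l _] /andP[_ c1r].
have xv : x * v != 0 by rewrite mulf_neq0// gt_eqF.
have sum0 : sol_norm x v c1 + sol_norm x v c2 = 0.
  have : x * v * (sol_norm x v c1 + sol_norm x v c2) * (t / 2) = 0.
    move: e1 e2; rewrite w0 wt subr0 sub0r (_ : t - t / 2 = t / 2); last by lra.
    rewrite subr0 => e1 e2; rewrite mulrDr mulrDl -e1 -e2; ring.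
  by move/eqP; rewrite mulf_eq0 (gt_eqF h0) orbF mulf_eq0 (negPf xv) => /eqP.
have [g1 g2] := (sol_norm_ge0 x v c1, sol_norm_ge0 x v c2).
have {}g1 : sol_norm x v c1 = 0 by lra.
have {}g2 : sol_norm x v c2 = 0 by lra.
have P0 : P x v != 0.
  by rewrite gt_eqF// ltr_wpDl ?sqr_ge0// lt_def sqrf_eq0 v0 sqr_ge0.
have /(mulfI P0) := etrans (sol_norm_eq0 g1) (esym (sol_norm_eq0 g2)).
move=> /eqP; rewrite eqrXn2 ?expR_ge0// => /eqP/expR_inj/mulfI.
by move=> /(_ (lt0r_neq0 x0)) c12; rewrite c12 in c1r; lra.
Qed.

End riccati.

Section complex_algebra.
Local Open Scope complex_scope.
Variable R : realType.
Implicit Types (t kappa : R) (z w a y : R[i]).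
Local Notation Re := (@complex.Re R).
Local Notation Im := (@complex.Im R).

Lemma Re_mulc z w : Re (z * w) = Re z * Re w - Im z * Im w.
Proof. by case: z => ? ?; case: w. Qed.

Lemma Im_mulc z w : Im (z * w) = Re z * Im w + Im z * Re w.
Proof. by case: z => ? ?; case: w. Qed.

Lemma normc_lt1 z : (`|z| < 1) = (Re z ^+ 2 + Im z ^+ 2 < 1).
Proof.
rewrite normc_def ltcE /= eqxx /= -(@ltr_pXn2r _ 2) ?nnegrE ?sqrtr_ge0//.
by rewrite sqr_sqrtr ?expr1n// addr_ge0 ?sqr_ge0.
Qed.

Lemma Re_H0 z : `|z| < 1 -> 0 < Re (H0 z).
Proof.
rewrite normc_lt1 /H0; case: z => x y; rewrite [in X in X -> _]/= => xy1.
have d0 : 0 < (1 - x) ^+ 2 + y ^+ 2.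
  by move: (sqr_ge0 y) (sqr_ge0 (1 - x)) (sqr_ge0 x); nra.
rewrite Re_mulc /=.
rewrite !add0r !sqrrN [X in 0 < X](_ : _ =
  (1 - (x ^+ 2 + y ^+ 2)) / ((1 - x) ^+ 2 + y ^+ 2)).
  by rewrite divr_gt0// subr_gt0.
by field; rewrite gt_eqF.
Qed.

(** The quantity a (1 - xi) / (1 + xi) is - u' / u at time t / 2, so its
imaginary part is a nonzero multiple of the wronskian. *)
Lemma Im_riccati_eq0 a t : 0 < Re a -> 0 < t -> xi t a != -1 ->
  Im (a * ((1 - xi t a) / (1 + xi t a))) = 0 -> Im a = 0.
Proof.
move=> a0 t0 x1; have xia : (a + 1) * xi t a = (a - 1) * cexp (t%:C * a).
  rewrite /xi mulrA mulrCA mulfV ?mulr1//.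
  apply: contraTneq a0 => /(congr1 Re)/eqP; case: (a) => x v /=.
  by rewrite addr_eq0 => /eqP ->; rewrite -leNgt lerN10.
have x1' : 1 + xi t a != 0 by rewrite addrC addr_eq0.
move: x1' xia; move: (xi t a) => xi0 x1' xia Im0.
have : Im (a * (1 - xi0) * (1 + xi0)^*) = 0.
  have -> : a * (1 - xi0) * (1 + xi0)^* = (a * ((1 - xi0) / (1 + xi0))) * `|1 + xi0| ^+ 2.
    by rewrite sqr_normc; field.
  by rewrite -add_Re2_Im2 Im_mulc Im0 mul0r addr0 /= mulr0.
apply: contraPeq => v0 H; case: a a0 v0 xia {Im0 x1} H => x v /= x0 v0.
case: xi0 {x1'} => r s /eqP; rewrite eq_complex /= !mul0r !subr0 !addr0.
move=> /andP[/eqP h1 /eqP h2] h3.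
have := wronskian_neq0 x0 v0 t0; apply/negP; rewrite negbK.
move: h1 h2; rewrite /wronskian expRN; have := expR_gt0 (x * t).
rewrite (mulrC t) (mulrC t) => E0.
have cs := cos2Dsin2 (v * t); move: E0 cs h3.
move: (expR _) (cos _) (sin _) => E c d E0 cs h3 h1 h2.
have D0 : (x+1) ^+ 2 + v ^+ 2 != 0.
  by rewrite gt_eqF// ltr_pwDl ?sqr_ge0// exprn_gt0// addr_gt0.
have Ds : ((x+1) ^+ 2 + v ^+ 2) * s = E * ((x^+2 + v^+2 -1) * d + 2 * v * c).
  transitivity ((x + 1) * ((x + 1) * s + v * r) - v * ((x + 1) * r - v * s)).
    by ring.
  by rewrite h1 h2; ring.
have Dn : ((x+1) ^+ 2 + v ^+ 2) * (r ^+ 2 + s ^+ 2) =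
    E ^+ 2 * ((x-1) ^+ 2 + v ^+ 2) * (c ^+ 2 + d ^+ 2).
  transitivity (((x + 1) * s + v * r) ^+ 2 + ((x + 1) * r - v * s) ^+ 2).
    by ring.
  by rewrite h1 h2; ring.
(* h3 is the imaginary part of a (1 - xi) conj (1 + xi); multiplying it by
   |a + 1|^2 and inserting Ds and Dn gives - E times the wronskian. *)
rewrite cs mulr1 in Dn.
have n0 : v * (1 - (r ^+ 2 + s ^+ 2)) - 2 * x * s = 0 by rewrite -[RHS]h3; ring.
have := congr1 (fun u => ((x+1) ^+ 2 + v ^+ 2) * u) n0.
rewrite mulr0 mulrBr mulrCA mulrBr mulr1 Dn (mulrCA _ (2 * x)) Ds => H.
apply/eqP; apply: (mulfI (lt0r_neq0 E0)); rewrite mulr0 -oppr0 -[in RHS]H.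
by field; rewrite gt_eqF.
Qed.

End complex_algebra.

(** * Branches of square roots far from the origin *)

Section far.
Local Open Scope complex_scope.
Variable R : realType.
Implicit Types (t kappa : R) (z w a y q F : R[i]).
Local Notation Re := (@complex.Re R).
Local Notation Im := (@complex.Im R).

(** Re (q conj F), the scalar product of the plane. *)
Definition cdot q F : R := Re q * Re F + Im q * Im F.

Lemma sqr_normcE z : normc z ^+ 2 = Re z ^+ 2 + Im z ^+ 2.
Proof. by case: z => x y; rewrite /= sqr_sqrtr// addr_ge0 ?sqr_ge0. Qed.

Lemma normcr_ge0 z : 0 <= normc z.
Proof. by case: z => x y; exact: sqrtr_ge0. Qed.

Lemma Re_le_normc z : Re z <= normc z.
Proof.
by rewrite (le_trans (ler_norm _))// -lecR; have := normc_ge_Re z; case: z.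
Qed.

Lemma normc_le_dot q F : 0 <= cdot q F -> normc F <= normc (q + F).
Proof.
move=> qF; rewrite -(@ler_pXn2r _ 2) ?nnegrE ?normcr_ge0// !sqr_normcE !raddfD /=.
move: qF; rewrite /cdot; move: (Re q) (Im q) (Re F) (Im F) => a b c d.
by move: (sqr_ge0 a) (sqr_ge0 b); nra.
Qed.

(** Two square roots of nearby numbers that form an acute angle are close: then
|q + F| >= |F| in |q - F| |q + F| = |q^2 - F^2|. *)
Lemma same_branch q F : 0 <= cdot q F ->
  normc (q - F) * normc F <= normc (q ^+ 2 - F ^+ 2).
Proof.
by move=> qF; rewrite subr_sqr normcM ler_wpM2l ?normcr_ge0// normc_le_dot.
Qed.

(** Here w and q are roots of a^2 - r and F^2 - r, and F is close to - a. If the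
angles (w, a) and (q, F) were acute, w would be close to a and q to F, so q would
be close to - w, against the acute angle (q, w). *)
Lemma branch_bound a w q F (r : R) : 0 <= r < 1 -> 3 <= normc a ->
  a ^+ 2 - w ^+ 2 = r%:C -> F ^+ 2 - q ^+ 2 = r%:C ->
  2 * normc (F + a) <= normc a ->
  0 <= cdot w a -> 0 <= cdot q w -> ~ (0 <= cdot q F).
Proof.
move=> /andP[r0 r1] a3 aw Fq Fa wa qw qF.
have nr : normc (r%:C) = r by rewrite /= expr0n /= addr0 sqrtr_sqr ger0_norm.
have wa' : normc (w - a) * normc a <= r.
  by rewrite (le_trans (same_branch wa))// -normcN opprB aw nr.
have qF' : normc (q - F) * normc F <= r.
  by rewrite (le_trans (same_branch qF))// -normcN opprB Fq nr.
have qw' := normc_le_dot qw.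
have h1 : normc a <= normc (F + a) + normc F.
  have {1}-> : a = (F + a) + - F by ring.
  by rewrite (le_trans (le_normcD _ _))// normcN.
have h2 : normc (q + w) <= normc (q - F) + normc (F + a) + normc (w - a).
  have -> : q + w = (q - F) + (F + a) + (w - a) by ring.
  by rewrite (le_trans (le_normcD _ _))// lerD2r le_normcD.
have h3 : normc a <= normc w + normc (w - a).
  have {1}-> : a = w + - (w - a) by ring.
  by rewrite (le_trans (le_normcD _ _))// normcN.
have wa3 : normc (w - a) <= 1 / 3 by move: (normcr_ge0 (w - a)); nra.
have qF3 : normc (q - F) <= 2 / 3 by move: (normcr_ge0 (q - F)); nra.
lra.
Qed.

(** Adding r >= 0 to w^2 moves the principal root to the right inside its own
quadrant. *)
Lemma sqrt_shift a w (r : R) : 0 <= r -> 0 < Re a -> 0 < Re w ->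
  a ^+ 2 - w ^+ 2 = r%:C -> 0 <= cdot w a /\ Re w <= Re a.
Proof.
case: a w => x v [p s] r0 /= x0 p0 /eqP; rewrite !expr2 eq_complex /=.
move=> /andP[/eqP e1 /eqP e2]; rewrite /cdot /=.
have xv : x * v = p * s by lra.
split.
  apply: addr_ge0; first by rewrite mulr_ge0// ltW.
  by rewrite -(pmulr_rge0 _ x0) mulrCA xv mulrCA -expr2 mulr_ge0 ?sqr_ge0// ltW.
rewrite leNgt; apply/negP => xp.
have : s ^+ 2 <= v ^+ 2.
  rewrite -(@ler_pM2l _ (x ^+ 2)) ?exprn_gt0// -!exprMn xv !exprMn.
  by rewrite ler_wpM2r ?sqr_ge0// ler_pXn2r ?nnegrE ?(ltW x0) ?(ltW p0)// ltW.
rewrite !expr2; nra.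
Qed.

Lemma normc2 : normc (2 : R[i]) = 2.
Proof.
rewrite -[2]/(2%:R) -(rmorph_nat (real_complex R)) /= expr0n addr0 sqrtr_sqr.
by rewrite ger0_norm.
Qed.

End far.

(** * The barrier *)

Section barrier.
Local Open Scope complex_scope.
Variable R : realType.
Variables (t kappa : R).
Hypothesis (t_gt0 : 0 < t) (kappa_itv : -1 < kappa < 1).
Implicit Types (z w y : R[i]).
Local Notation Re := (@complex.Re R).
Local Notation Im := (@complex.Im R).

#[local] Hint Extern 0 (Filter _) =>
  solve [apply: (@nbhs_filter R[i])] : typeclass_instances.

(** This is - u' / u at time t / 2, for the solution u of u'' = a^2 u with
u 0 = 1 and u' 0 = -1. *)
Definition riccati_end z : R[i] :=
  let a := a_ kappa (H0 z) in a * ((1 - xi t a) / (1 + xi t a)).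

(** Since psi = (1 - p) / (1 + p) with p = sqrt (1 - psi_arg), this is
H0 z / H0 (psi z). *)
Definition loewner_end z : R[i] := H0 z * sqrtc (1 - psi_arg kappa t z).

Let k2_gt0 : 0 < 1 - kappa ^+ 2.
Proof. move: kappa_itv => /andP[]; nra. Qed.

Lemma a_radicand y : 0 < Re y ->
  ~~ ((kappa ^+ 2)%:C + (1 - kappa ^+ 2)%:C * y ^+ 2 <= 0).
Proof.
case: y => p s /= p0; rewrite expr2 lecE /= !mul0r ?addr0 ?add0r subr0.
apply/negP => /andP[/eqP h1 h2].
have s0 : s = 0.
  have : 2 * (1 - kappa ^+ 2) * p * s = 0 by rewrite [RHS]h1; ring.
  by move/eqP; rewrite mulf_eq0 => /orP[/eqP|/eqP//]; nra.
move: h2; rewrite s0 leNgt => /negP; apply.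
by rewrite mul0r subr0 ltr_wpDl ?sqr_ge0// mulr_gt0// mulr_gt0.
Qed.

Lemma Re_a_gt0 y : 0 < Re y -> 0 < Re (a_ kappa y).
Proof. by move=> y0; apply/Re_sqrtc_gt0/a_radicand. Qed.

Lemma sqr_a y : a_ kappa y ^+ 2 = (kappa ^+ 2)%:C + (1 - kappa ^+ 2)%:C * y ^+ 2.
Proof. by rewrite sqr_sqrtc. Qed.

Lemma Re_gt0_neq0 y : 0 < Re y -> y != 0.
Proof. by apply: contraTneq => ->; rewrite ltxx. Qed.

(** The formula for psi_arg in terms of eta = (1 - xi) / (1 + xi), for which
alpha_inv xi = 1 - eta^2. *)
Lemma loewner_riccati z : `|z| < 1 -> xi t (a_ kappa (H0 z)) != -1 ->
  riccati_end z ^+ 2 - (1 - kappa ^+ 2)%:C * loewner_end z ^+ 2 = (kappa ^+ 2)%:C.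
Proof.
move=> /Re_H0 /Re_gt0_neq0 yn x1; rewrite /riccati_end /loewner_end /psi_arg.
have ye := sqr_a (H0 z); move: yn x1 ye.
move: (H0 z) => y; move: (xi _ _) => x; move: (a_ _ _) => a yn x1 ye.
have x1' : 1 + x != 0 by rewrite addrC addr_eq0.
have k0 : (1 - kappa ^+ 2)%:C != 0 :> R[i].
  by rewrite (inj_eq (@complexI _)) gt_eqF.
have -> : (kappa ^+ 2)%:C = a ^+ 2 - (1 - kappa ^+ 2)%:C * y ^+ 2.
  by rewrite ye addrK.
move: k0; move: (1 - _)%:C => K k0.
by rewrite [(y * _) ^+ 2]exprMn sqr_sqrtc /alpha_inv subKr; field; rewrite x1' yn k0.
Qed.

Lemma Re_loewner_root z : psi_dom kappa t z -> 0 < Re (sqrtc (1 - psi_arg kappa t z)).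
Proof.
by move=> [_ _ f1]; apply/Re_sqrtc_gt0; apply: contra f1; rewrite subr_le0.
Qed.

(** Positive when F and Y are on matching branches of
(1 - kappa^2) Y^2 = F^2 - kappa^2, negative when they are on opposite ones. *)
Definition side z : R := cdot (loewner_end z) (riccati_end z).

(** The relation (1 - kappa^2) Y^2 = F^2 - kappa^2 gives
(1 - kappa^2) Re Y Im Y = Re F Im F, so the products Re Y Re F and Im Y Im F have
the same sign and can only cancel when both vanish. If Im F is nonzero then
Y is real and F imaginary, and the two sides of the relation have opposite
signs. If Im F = 0 then y is real, so Re Y is nonzero, F = 0 and Y is real, and
the relation fails again. *)
Lemma side_neq0 z : psi_dom kappa t z -> side z != 0.
Proof.
move=> zd; have [z1 x1 _] := zd; have p0 := Re_loewner_root zd.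
have y0 := Re_H0 z1; have a0 := Re_a_gt0 y0.
have lr := loewner_riccati z1 x1.
have F0 : Im (riccati_end z) = 0 -> Im (H0 z) = 0.
  move=> /(Im_riccati_eq0 a0 t_gt0 x1) a0'.
  have := congr1 Im (sqr_a (H0 z)).
  rewrite !expr2 Im_mulc a0' mulr0 mul0r addr0 raddfD /= add0r Im_mulc /=.
  rewrite mul0r addr0 Im_mulc.
  have -> : Re (H0 z) * Im (H0 z) + Im (H0 z) * Re (H0 z) =
    2 * Re (H0 z) * Im (H0 z) by ring.
  move/esym/eqP; rewrite !mulf_eq0 (gt_eqF y0) pnatr_eq0 /= => /orP[|/eqP//].
  by rewrite -!expr2 gt_eqF.
have Y0 : Im (riccati_end z) = 0 -> Re (loewner_end z) != 0.
  by move=> /F0 yr; rewrite /loewner_end Re_mulc yr mul0r subr0 mulf_neq0// gt_eqF.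
move: lr F0 Y0 => /eqP; rewrite /side /cdot.
case: (loewner_end z) => y1 y2; case: (riccati_end z) => f1 f2.
rewrite !expr2 eq_complex /= !mul0r !subr0 !addr0 => /andP[/eqP h1 /eqP h2] _.
rewrite -!expr2 in h1 h2.
move=> y1n; apply/eqP => s0; move: k2_gt0 h1 h2.
move: (1 - _) => K K0 h1 h2.
have yf : y1 * f1 = - (y2 * f2) by lra.
have f12 : f1 * f2 = K * (y1 * y2) by lra.
have e : (y2 * f2) ^+ 2 + K * (y1 * y2) ^+ 2 = 0.
  transitivity (y1 * y2 * (K * (y1 * y2)) - y1 * f1 * (y2 * f2)).
    by rewrite yf; ring.
  by rewrite -f12; ring.
have [/eqP + /eqP] : (y2 * f2) ^+ 2 = 0 /\ K * (y1 * y2) ^+ 2 = 0.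
  by move: (sqr_ge0 (y2 * f2)) (mulr_ge0 (ltW K0) (sqr_ge0 (y1 * y2))); lra.
rewrite sqrf_eq0 mulf_eq0 mulf_eq0 (gt_eqF K0)/= sqrf_eq0 mulf_eq0.
have kp := sqr_ge0 kappa.
have [f20 _|f20] := eqVneq f2 0.
  have {}y1n := y1n f20; rewrite (negPf y1n) /= => /eqP y20.
  move: yf; rewrite y20 mul0r oppr0 => /eqP; rewrite mulf_eq0 (negPf y1n) /= => /eqP f10.
  move: h1; rewrite f20 f10 y20 !expr0n /= !subr0 sub0r.
  have : 0 < K * y1 ^+ 2 by rewrite mulr_gt0// lt_def sqrf_eq0 y1n sqr_ge0.
  by lra.
rewrite orbF => /eqP y20 _; move: f12; rewrite y20 !mulr0 => /eqP.
rewrite mulf_eq0 (negPf f20) orbF => /eqP f10.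
move: h1; rewrite f10 y20 !expr0n /= subr0 sub0r.
have : 0 < f2 ^+ 2 by rewrite lt_def sqrf_eq0 f20 sqr_ge0.
have := mulr_ge0 (ltW K0) (sqr_ge0 y1); lra.
Qed.

Lemma side_continuous z : psi_dom kappa t z -> {for z, continuous side}.
Proof.
move=> [z1 x1 f1].
have y0 := Re_H0 z1; have a0 := Re_a_gt0 y0.
have yn := Re_gt0_neq0 y0; have an := Re_gt0_neq0 a0.
have ye := sqr_a (H0 z).
have x1' : 1 + xi t (a_ kappa (H0 z)) != 0 by rewrite addrC addr_eq0.
have k0 : (1 - kappa ^+ 2)%:C != 0 :> R[i].
  by rewrite (inj_eq (@complexI _)) gt_eqF.
have z1' : 1 - z != 0.
  by apply: contraTneq z1 => /eqP; rewrite subr_eq0 => /eqP <-; rewrite normr1 ltxx.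
have id_z : w @[w --> z] --> z by exact: cvg_id.
have cc (c : R[i]) : c @[w --> z] --> c by exact: cvg_cst.
have H0c : H0 w @[w --> z] --> H0 z.
  rewrite /H0; apply: (cvgM (cvgD (cc 1) id_z)).
  exact: (cvgV z1' (cvgB (cc 1) id_z)).
have ac : a_ kappa (H0 w) @[w --> z] --> a_ kappa (H0 z).
  have rc : (kappa ^+ 2)%:C + (1 - kappa ^+ 2)%:C * (H0 w * H0 w) @[w --> z] -->
      (kappa ^+ 2)%:C + (1 - kappa ^+ 2)%:C * (H0 z * H0 z).
    exact: (cvgD (cc _) (cvgM (cc _) (cvgM H0c H0c))).
  exact: (cvg_comp _ _ rc (sqrtc_continuous (a_radicand y0))).
have xic : xi t (a_ kappa (H0 w)) @[w --> z] --> xi t (a_ kappa (H0 z)).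
  rewrite /xi; apply: cvgM.
    apply: (cvgM (cvgB ac (cc 1))); apply: (cvgV _ (cvgD ac (cc 1))).
    apply: contraTneq a0 => /eqP; rewrite addr_eq0 => /eqP ->.
    by rewrite raddfN /= oppr_gt0 ltr10.
  have ta : t%:C * a_ kappa (H0 w) @[w --> z] --> t%:C * a_ kappa (H0 z).
    exact: (cvgM (cc _) ac).
  exact: (cvg_comp _ _ ta (@cexp_continuous _ _)).
have Fc : riccati_end w @[w --> z] --> riccati_end z.
  rewrite /riccati_end /=; apply: (cvgM ac); apply: (cvgM (cvgB (cc 1) xic)).
  exact: (cvgV x1' (cvgD (cc 1) xic)).
have a2c : a_ kappa (H0 w) * a_ kappa (H0 w) @[w --> z] -->
    a_ kappa (H0 z) * a_ kappa (H0 z) by exact: (cvgM ac ac).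
have fc : psi_arg kappa t w @[w --> z] --> psi_arg kappa t z.
  rewrite /psi_arg /=; apply: cvgM.
    apply: (cvgM a2c); apply: (cvgV _ (cvgB a2c (cc _))).
    by rewrite -expr2 ye addrAC subrr add0r mulf_neq0// expf_neq0.
  rewrite /alpha_inv; apply: (cvgM (cvgM (cc 4) xic)).
  have x1c : 1 + xi t (a_ kappa (H0 w)) @[w --> z] --> 1 + xi t (a_ kappa (H0 z)).
    exact: (cvgD (cc 1) xic).
  by apply: (cvgV _ (cvgM x1c x1c)); rewrite mulf_neq0.
have Yc : loewner_end w @[w --> z] --> loewner_end z.
  rewrite /loewner_end; apply: (cvgM H0c).
  have f1c : 1 - psi_arg kappa t w @[w --> z] --> 1 - psi_arg kappa t z.
    exact: (cvgB (cc 1) fc).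
  apply: (cvg_comp _ _ f1c); apply: sqrtc_continuous.
  by rewrite subr_le0.
have Re_c (f : R[i] -> R[i]) a : f w @[w --> z] --> a -> Re (f w) @[w --> z] --> Re a.
  by move=> fa; exact: (cvg_comp _ _ fa (@Re_continuous _ _)).
have Im_c (f : R[i] -> R[i]) a : f w @[w --> z] --> a -> Im (f w) @[w --> z] --> Im a.
  by move=> fa; exact: (cvg_comp _ _ fa (@Im_continuous _ _)).
rewrite /side /cdot.
exact: (cvgD (cvgM (Re_c _ _ Yc) (Re_c _ _ Fc)) (cvgM (Im_c _ _ Yc) (Im_c _ _ Fc))).
Qed.

End barrier.

(** * The bound on Lambda *)

Section bounded.
Local Open Scope complex_scope.
Variable R : realType.
Variables (t kappa : R).
Hypothesis (t_gt0 : 0 < t) (kappa_itv : -1 < kappa < 1).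
Implicit Types (z w y : R[i]).
Local Notation Re := (@complex.Re R).
Local Notation Im := (@complex.Im R).

Lemma H00 : H0 0 = 1 :> R[i].
Proof. by rewrite /H0 addr0 subr0 divff ?oner_eq0. Qed.

Lemma side0 : side t kappa 0 = 1.
Proof.
have a1 : a_ kappa 1 = 1.
  by rewrite /a_ expr1n mulr1 -rmorphD [_ + _](_ : _ = 1) ?sqrtc1//; ring.
have x0 : xi t 1 = 0 by rewrite /xi subrr !mul0r.
rewrite /side /loewner_end /riccati_end /psi_arg H00 a1 x0 /alpha_inv.
rewrite !(mulr0, mul0r, subr0, addr0) sqrtc1 divr1 mulr1.
by rewrite /cdot /= mulr1 mulr0 addr0.
Qed.

(** A continuous function without zeros keeps its sign on a connected set. *)
Lemma side_gt0 z : Lambda kappa t z -> 0 < side t kappa z.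
Proof.
move=> Lz.
have d0 : psi_dom kappa t 0.
  apply/not_notP => n0; move: Lz; rewrite /Lambda.
  by rewrite connected_component_out.
have L0 : Lambda kappa t 0 by exact: connected_component_refl.
have sub : Lambda kappa t `<=` psi_dom kappa t by exact: connected_component_sub.
have : connected (side t kappa @` Lambda kappa t).
  apply: connected_continuous_connected; first exact: component_connected.
  apply: continuous_in_subspaceT => w /set_mem/sub.
  exact: side_continuous.
move/connected_intervalP => itv; rewrite ltNge; apply/negP => s0.
have [w Lw w0] : (side t kappa @` Lambda kappa t) 0.
  apply: (itv (side t kappa z) (side t kappa 0)); [by exists z|by exists 0|].
  by rewrite side0 s0 ler01.
by have := side_neq0 t_gt0 kappa_itv (sub _ Lw); rewrite w0 eqxx.
Qed.

Lemma normc_cexp z : normc (cexp z) = expR (Re z).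
Proof.
case: z => x y; rewrite /= !exprMn -mulrDr cos2Dsin2 mulr1 sqrtr_sqr.
by rewrite ger0_norm ?expR_ge0.
Qed.

(** For Re a >= 3 the factor (a - 1) / (a + 1) has modulus at least 1/2, and
exp (t Re a) >= 1 + t Re a >= 10. *)
Lemma xi_large a : 3 <= Re a -> 9 <= t * Re a -> 5 <= normc (xi t a).
Proof.
move=> a3 ta9.
have a1 : 0 < normc (a + 1).
  by apply: lt_le_trans (Re_le_normc _); rewrite raddfD /=; lra.
have a2 : 2 <= normc (a - 1).
  by apply: le_trans (Re_le_normc _); rewrite raddfB /=; lra.
have ratio : normc (a + 1) <= 2 * normc (a - 1).
  have -> : a + 1 = (a - 1) + 2 by ring.
  by apply: le_trans (le_normcD _ _) _; rewrite normc2; lra.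
have e10 : 10 <= normc (cexp (t%:C * a)).
  rewrite normc_cexp Re_mulc /= mul0r subr0.
  by apply: le_trans (expR_ge1Dx _); lra.
rewrite /xi !normcM normcV -mulrAC ler_pdivlMr//.
nra.
Qed.

(** Re a >= sqrt (1 - kappa^2) Re y, so this bound on Re y makes Re a >= 3 and
t Re a >= 9. *)
Definition Re_bound : R := (3 + 9 / t) / Num.sqrt (1 - kappa ^+ 2).

(** Far to the right |xi| >= 5, so F + a = 2 a / (1 + xi) is at most |a| / 2 in
modulus, and [branch_bound] applies to w = sqrt (1 - kappa^2) y and
q = sqrt (1 - kappa^2) Y. *)
Lemma side_lt0 z : psi_dom kappa t z -> Re_bound <= Re (H0 z) -> side t kappa z < 0.
Proof.
move=> zd zw; have [z1 x1 _] := zd.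
have y0 := Re_H0 z1; have a0 := Re_a_gt0 kappa_itv y0.
set k := Num.sqrt (1 - kappa ^+ 2).
have k2_gt0 : 0 < 1 - kappa ^+ 2 by move: kappa_itv => /andP[]; nra.
have k0 : 0 < k by rewrite sqrtr_gt0.
have kk : (k%:C : R[i]) ^+ 2 = (1 - kappa ^+ 2)%:C by rewrite -rmorphXn sqr_sqrtr// ltW.
set w := k%:C * H0 z; set q := k%:C * loewner_end t kappa z.
set a := a_ kappa (H0 z); set F := riccati_end t kappa z.
have Rew : Re w = k * Re (H0 z) by rewrite Re_mulc /= mul0r subr0.
have w0 : 0 < Re w by rewrite Rew mulr_gt0.
have aw : a ^+ 2 - w ^+ 2 = (kappa ^+ 2)%:C by rewrite sqr_a [w ^+ 2]exprMn kk addrK.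
have Fq : F ^+ 2 - q ^+ 2 = (kappa ^+ 2)%:C by rewrite [q ^+ 2]exprMn kk loewner_riccati.
have [wa wra] := sqrt_shift (sqr_ge0 kappa) a0 w0 aw.
have ta : 3 + 9 / t <= Re a.
  by apply: le_trans wra; rewrite Rew [k * _]mulrC -ler_pdivrMr//; exact: zw.
have t9 : 0 < 9 / t by rewrite divr_gt0.
have a3 : 3 <= Re a by lra.
have ta9 : 9 <= t * Re a.
  rewrite mulrC -ler_pdivrMr//; lra.
have x5 := xi_large a3 ta9.
rewrite ltNge; apply/negP => s0.
have r1 : 0 <= kappa ^+ 2 < 1 by rewrite sqr_ge0 -subr_gt0.
apply: (branch_bound r1 _ aw Fq _ wa); first exact: le_trans (Re_le_normc _).
- have x1' : 1 + xi t a != 0 by rewrite addrC addr_eq0.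
  have -> : F + a = a * (2 / (1 + xi t a)) by rewrite /F /riccati_end -/a; field.
  rewrite 2!normcM normcV normc2.
  have h4 : 4 <= normc (1 + xi t a).
    have : normc (xi t a) <= normc (1 + xi t a) + 1.
      have {1}-> : xi t a = (1 + xi t a) + - 1 by ring.
      by rewrite (le_trans (le_normcD _ _))// normcN normc1.
    lra.
  rewrite mulrCA ler_piMr ?normcr_ge0// mulrA ler_pdivrMr; lra.
- rewrite /q /w /cdot /loewner_end.
  have := Re_loewner_root zd.
  move: (sqrtc _) => [p s] /= p0; move: (H0 z) => [y v] /=.
  rewrite (_ : _ + _ = k ^+ 2 * p * (y ^+ 2 + v ^+ 2)); last by ring.
  by rewrite mulr_ge0 ?addr_ge0 ?sqr_ge0// mulr_ge0 ?sqr_ge0// ltW.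
- move: s0; rewrite /side -/F /cdot /q.
  case: (loewner_end _ _ _) => y1 y2; case: (F) => v1 v2 /= s0.
  rewrite !mul0r subr0 addr0 -!mulrA -mulrDr.
  by rewrite mulr_ge0// ltW.
Qed.

Lemma Re_H0_Lambda z : Lambda kappa t z -> Re (H0 z) < Re_bound.
Proof.
move=> Lz; rewrite ltNge; apply/negP => zw.
have zd := connected_component_sub Lz.
by have := lt_trans (side_gt0 Lz) (side_lt0 zd zw); rewrite ltxx.
Qed.

(** The value 0 is the default taken by psi_inv off the image of Lambda. *)
Lemma psi_inv_range z : psi_inv kappa t z = 0 \/ Lambda kappa t (psi_inv kappa t z).
Proof.
have [zi|zi] := pselect ((psi kappa t @` Lambda kappa t) z).
  by right; exact: ('funS_('pinv_(fun=> 0) (Lambda kappa t) (psi kappa t)) zi).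
left; rewrite /psi_inv /pinv_ splitV oinv_surj /=.
by case: pselect.
Qed.

Lemma Re_H0_psi_inv z : Re (H0 (psi_inv kappa t z)) <= Re_bound + 1.
Proof.
have w0 : 0 <= Re_bound.
  by rewrite divr_ge0 ?sqrtr_ge0// addr_ge0// divr_ge0// ltW.
have [->|/Re_H0_Lambda/ltW h] := psi_inv_range z; first by rewrite H00 /= lerDr.
by rewrite (le_trans h)// lerDl.
Qed.

End bounded.

(** * From the bound to the measure *)

Section clark.
Local Open Scope complex_scope.
Variable R : realType.
Local Notation Re := (@complex.Re R).
Local Notation Im := (@complex.Im R).
Local Notation Circ := (Borel_circle R).

Definition sqdist (w z : R[i]) : R := (Re w - Re z) ^+ 2 + (Im w - Im z) ^+ 2.

Lemma circleE (w : Circ) : Re (val w) ^+ 2 + Im (val w) ^+ 2 = 1.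
Proof.
have : `|val w| = 1 by have := valP w; rewrite inE.
case: (val w) => x y; rewrite normc_def => -[h].
by rewrite -[LHS]sqr_sqrtr ?addr_ge0 ?sqr_ge0// h expr1n.
Qed.

Lemma continuous_circle_measurable (g : circle R -> R) :
  continuous g -> measurable_fun setT (g : Circ -> R).
Proof.
move=> cg; apply: (measurability _ (measurable_realfun.RGenOInfty.measurableE R)) => //.
move=> /= _ [_ [x ->] <-]; rewrite setTI; apply: sub_sigma_algebra.
by apply: open_comp => // z _; exact: cg.
Qed.

#[local] Hint Extern 0 (Filter _) =>
  solve [apply: (@nbhs_filter R[i])] : typeclass_instances.

Lemma sqdist_continuous z : continuous (fun w : circle R => sqdist (val w) z).
Proof.
have vc : continuous (fun w : circle R => val w).
  by apply/continuousP => A oA; exists A.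
have sc u : sqdist v z @[v --> u] --> sqdist u z.
  have cc (c : R) : c @[_ --> u] --> c by exact: cvg_cst.
  have Rc : Re v - Re z @[v --> u] --> Re u - Re z.
    exact: (cvgB (@Re_continuous R u) (cc _)).
  have Ic : Im v - Im z @[v --> u] --> Im u - Im z.
    exact: (cvgB (@Im_continuous R u) (cc _)).
  exact: (cvgD (cvgM Rc Rc) (cvgM Ic Ic)).
move=> w; exact: (cvg_comp _ _ (vc w) (sc _)).
Qed.

Lemma measurable_sqdist z : measurable_fun setT (fun w : Circ => sqdist (val w) z).
Proof. exact: (continuous_circle_measurable (@sqdist_continuous z)). Qed.

Definition disk z (d : R) : set Circ := [set w | sqdist (val w) z <= d ^+ 2].

Lemma measurable_disk z d : measurable (disk z d).
Proof.
rewrite (_ : disk z d =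
  (fun w : Circ => sqdist (val w) z) @^-1` `]-oo, d ^+ 2]%classic).
  by rewrite -[X in measurable X]setTI; exact: measurable_sqdist.
by apply/seteqP; split => w; rewrite /disk /= in_itv.
Qed.

Lemma Re_kernel (w : Circ) z : sqdist (val w) z != 0 ->
  Re ((val w + z) / (val w - z)) = (1 - (Re z ^+ 2 + Im z ^+ 2)) / sqdist (val w) z.
Proof.
rewrite -(circleE w) /sqdist; case: (val w) z => a b [x y] /= d0.
by field.
Qed.

(** For unit vectors, |w - r w0|^2 = 1 + r^2 - r (2 - |w - w0|^2). *)
Lemma sqdist_radial (w w0 : Circ) (r : R) :
  sqdist (val w) (r%:C * val w0) = (1 - r) ^+ 2 + r * sqdist (val w) (val w0).
Proof.
have := circleE w; have := circleE w0; rewrite /sqdist.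
case: (val w) (val w0) => a b [c d] /= h1 h2; rewrite !mul0r subr0 addr0.
have -> : (a - r * c) ^+ 2 + (b - r * d) ^+ 2 =
    (a ^+ 2 + b ^+ 2) + r ^+ 2 * (c ^+ 2 + d ^+ 2) - 2 * r * (a * c + b * d) by ring.
have -> : (a - c) ^+ 2 + (b - d) ^+ 2 =
    (a ^+ 2 + b ^+ 2) + (c ^+ 2 + d ^+ 2) - 2 * (a * c + b * d) by ring.
by rewrite h1 h2; ring.
Qed.

Lemma circle_expi (w : Circ) : exists2 x : R, 0 <= x < 2 * pi & w = expi x.
Proof.
have := circleE w; set a := Re _; set b := Im _ => ab.
have we : val w = a +i* b by rewrite /a /b; case: (val w).
have a1 : -1 <= a <= 1.
  by rewrite -ler_norml -(expr_le1 (n:=2))// real_normK ?num_real// -ab lerDl sqr_ge0.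
have [ca sa] := (acosK (x:=a), sin_acos a1).
have {}ca : cos (acos a) = a by apply: ca; rewrite in_itv.
have {}sa : sin (acos a) = `|b|.
  by rewrite sa -sqrtr_sqr -ab addrAC subrr add0r.
have [pi0 [acos0 acosp]] := (pi_gt0 R, (acos_ge0 a1, acos_lepi a1)).
have [b0|b0] := leP 0 b.
  exists (acos a); first by rewrite acos0 /=; lra.
  by apply: val_inj => /=; rewrite ca sa ger0_norm.
have a_lt1 : a < 1.
  rewrite lt_neqAle; case/andP: a1 => _ ->; rewrite andbT; apply/eqP => a1.
  by move: ab; rewrite a1; nra.
exists (2 * pi - acos a).
  have : 0 < acos a by rewrite acos_gt0// a_lt1; case/andP: a1 => ->.
  by move=> ?; apply/andP; split; lra.
have -> : 2 * pi - acos a = - acos a + pi *+ 2 by rewrite mulr_natl addrC.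
by apply: val_inj => /=; rewrite cosD2pi sinD2pi cosN sinN ca sa ltr0_norm// opprK we.
Qed.

Lemma sqdist_expi (x y : R) :
  sqdist (val (expi x)) (val (expi y)) <= 2 * (x - y) ^+ 2.
Proof.
wlog xy : x y / x <= y.
  move=> H; have [|/ltW] := leP x y; first exact: H.
  move=> /H; rewrite /sqdist -(opprB x y) sqrrN => h.
  by rewrite -(opprB (Re _)) -(opprB (Im _)) !sqrrN.
have cont (f df : R -> R) : (forall s : R, is_derive s 1 f (df s)) ->
    (forall s, `|df s| <= 1) -> (f x - f y) ^+ 2 <= (x - y) ^+ 2.
  move=> fd df1; have [|s _ e] := MVT_segment xy (fun s _ => fd s).
    apply: continuous_subspaceT => s.
    by apply/differentiable_continuous/derivable1_diffP; have [] := fd s.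
  rewrite -(opprB (f y)) sqrrN e exprMn -(opprB y x) sqrrN ler_piMl ?sqr_ge0//.
  by rewrite -real_normK ?num_real// expr_le1.
rewrite /sqdist /= mulr_natl mulr2n lerD//.
- apply: (cont _ (fun s => - sin s)) => s.
  by rewrite normrN ler_norml sin_geN1 sin_le1.
- apply: (cont _ cos) => s; by rewrite ler_norml cos_geN1 cos_le1.
Qed.

Section growth.
Variables (phi : R[i] -> R[i]) (N : probability Circ R) (C : R).
Hypothesis N_Clark : is_Clark_measure_at_1 phi N.
Hypothesis C_ge1 : 1 <= C.
Hypothesis phi_le : forall z, Re (H0 (phi z)) <= C.

(** Apply the bound on the Poisson integral at the point (1 - d) w0. Its squared
distance to the disc of radius d around w0 is at most 2 d^2 and the numerator of
the kernel is 1 - (1 - d)^2 >= d, so the kernel is at least 1 / (2 d) there. *)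
Lemma clark_disk_small (w0 : Circ) d : 0 < d < 1 ->
  (N (disk (val w0) d) <= (2 * C * d)%:E)%E.
Proof.
move=> /andP[d0 d1]; pose z := (1 - d)%:C * val w0.
have d1' : 0 < 1 - d by rewrite subr_gt0.
have z2 : Re z ^+ 2 + Im z ^+ 2 = (1 - d) ^+ 2.
  rewrite /z -[RHS]mulr1 -(circleE w0); case: (val w0) => a b /=.
  by rewrite !mul0r subr0 addr0; ring.
have z1 : `|z| < 1 by rewrite normc_lt1 z2 expr_lt1// ?ltW//; lra.
have dist_ge (w : Circ) : d ^+ 2 <= sqdist (val w) z.
  rewrite /z sqdist_radial subKr lerDl mulr_ge0 ?(ltW d1')//.
  by rewrite addr_ge0 ?sqr_ge0.
have dist_gt0 (w : Circ) : 0 < sqdist (val w) z.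
  by apply: lt_le_trans (dist_ge w); rewrite exprn_gt0.
pose P (w : Circ) := (1 - (1 - d) ^+ 2) / sqdist (val w) z.
have c0 : 0 <= 1 - (1 - d) ^+ 2 by nra.
have P0 w : 0 <= P w by rewrite divr_ge0// ltW.
have mP : measurable_fun setT P.
  apply: continuous_circle_measurable => w.
  have sw := @sqdist_continuous z w.
  by apply: (cvgM _ (cvgV _ sw)); [exact: cvg_cst|rewrite gt_eqF].
have iP : N.-integrable setT (EFin \o P).
  apply: measurable_bounded_integrable => //.
    by apply: le_lt_trans (ltry 1%R); apply: probability_le1.
  exists ((1 - (1 - d) ^+ 2) / d ^+ 2); split; first exact: num_real.
  move=> M hM w _ /=; rewrite ger0_norm// (le_trans _ (ltW hM))//.
  rewrite ler_wpM2l// lef_pV2 ?posrE ?exprn_gt0//.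
have PC : (\int[N]_w (P w)%:E <= C%:E)%E.
  have := phi_le z; rewrite (N_Clark z1) /Herglotz /cintegral /=.
  have -> : \int[N]_w Re ((val w + z) / (val w - z)) = \int[N]_w P w.
    by apply: eq_Rintegral => w _; rewrite Re_kernel ?gt_eqF// z2.
  rewrite -lee_fin /Rintegral fineK//; exact: integrable_fin_num.
have : ((1 / (2 * d))%:E * N (disk (val w0) d) <= C%:E)%E.
  apply: le_trans PC; rewrite -integral_cst; last exact: measurable_disk.
  apply: (@le_trans _ _ (\int[N]_(w in disk (val w0) d) (P w)%:E)%E).
    apply: ge0_le_integral => //.
    - exact: measurable_disk.
    - by move=> w _; rewrite lee_fin divr_ge0// mulr_ge0// ltW.
    - by apply/measurable_EFinP; exact: measurable_funTS.
    - move=> w dw; rewrite lee_fin /P ler_pdivlMr// mulrAC ler_pdivrMr ?mulr_gt0// mul1r.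
      have : sqdist (val w) z <= 2 * d ^+ 2.
        rewrite /z sqdist_radial subKr.
        have : 0 <= sqdist (val w) (val w0) by rewrite addr_ge0 ?sqr_ge0.
        move: dw; rewrite /disk /= => dw s0; nra.
      by nra.
  apply: ge0_subset_integral => //.
  - exact: measurable_disk.
  - exact/measurable_EFinP.
  - by move=> w _; rewrite lee_fin.
have Nfin : N (disk (val w0) d) \is a fin_num.
  exact: fin_num_measure (measurable_disk _ _).
rewrite -(fineK Nfin) -EFinM !lee_fin mul1r mulrC ler_pdivrMr ?mulr_gt0//.
by rewrite mulrA (mulrC C).
Qed.

Lemma clark_disk (w0 : Circ) d : 0 < d ->
  (N (disk (val w0) d) <= (2 * C * d)%:E)%E.
Proof.
move=> d0; have [d1|d1] := ltP d 1; first by rewrite clark_disk_small ?d0.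
rewrite (le_trans (probability_le1 N (measurable_disk _ _)))// lee_fin.
by move: C_ge1; nra.
Qed.

(** Lebesgue measure is an infimum over countable covers by half-open intervals,
and the image of an interval of length l under the 1-Lipschitz maps cos and sin
lies in a disc of radius 2 l, which has mass at most 4 C l. *)
Lemma clark_le_arc_length (A : set Circ) : measurable A ->
  (N A <= (4 * C)%:E * arc_length R A)%E.
Proof.
move=> mA; set D : set R := @expi R @^-1` A `&` `[0, 2 * pi[%classic.
have -> : arc_length R A = lebesgue_measure D by [].
have C0 : 0 < 4 * C by move: C_ge1; lra.
rewrite -lee_pdivrMl//.
have Nfin : N A \is a fin_num by exact: fin_num_measure.
apply: le_ereal_inf_tmp => _ [F [mF DF] <-].
rewrite lee_pdivrMl// -nneseriesZl//.
pose B k := if pselect (F k = set0) then set0 else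
   disk (val (expi (sup (F k)))) (2 * (sup (F k) - inf (F k))).
have FB k : F k = set0 \/ exists2 ab, ab.1 < ab.2 & F k = `]ab.1, ab.2]%classic.
  have /ocitvP[|[ab ab1 ->]] : ocitv (F k) by exact: mF.
    by left.
  by right; exists ab.
have mB k : measurable (B k).
  by rewrite /B; case: pselect => [?|?] //=; exact: measurable_disk.
have AB : A `<=` \bigcup_k B k.
  move=> w Aw; have [x x2 wE] := circle_expi w.
  have Dx : D x by split; [rewrite /preimage /= -wE|rewrite /= in_itv].
  have [k _ Fx] := DF _ Dx.
  exists k => //; rewrite /B; case: pselect => [F0|Fn] /=; first by rewrite F0 in Fx.
  have [//|[[a b] /= ab FE]] := FB k.
  rewrite FE sup_itv// inf_itv// wE /disk /=.
  rewrite (le_trans (sqdist_expi _ _))//.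
  move: Fx; rewrite FE /= in_itv /= => /andP[ax xb]; nra.
apply: (le_trans (measure_sigma_subadditive _ mB mA AB)).
apply: lee_nneseries => // k _; rewrite /B; case: pselect => [F0|Fn] /=.
  by rewrite F0 measure0 wlength0 mule0.
have [//|[[a b] /= ab FE]] := FB k.
rewrite FE sup_itv// inf_itv// wlength_itv /= lte_fin ab -EFinM.
have ba : 0 < 2 * (b - a) by rewrite mulr_gt0// subr_gt0.
apply: (le_trans (clark_disk (expi b) ba)).
by rewrite lee_fin; lra.
Qed.

End growth.

Lemma arc_length_setT : (arc_length R setT < +oo)%E.
Proof.
rewrite /arc_length /pushforward /mrestr preimage_setT setTI.
by rewrite lebesgue_measure_itv /=; case: ifP; rewrite ?ltry.
Qed.

Lemma arc_length_fin : fin_num_fun (arc_length R).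
Proof.
move=> A mA; rewrite ge0_fin_numE// (le_lt_trans _ arc_length_setT)//.
by rewrite le_measure ?inE.
Qed.

HB.instance Definition _ := Measure_isFinite.Build _ _ _ (arc_length R) arc_length_fin.

(** On the set where the Radon-Nikodym derivative g exceeds K, the integral of
the positive function g - K is N S - K arc_length S <= 0, so this set is
null. *)
Lemma bounded_density (N : {finite_measure set Circ -> \bar R}) (K : R) :
  (forall A, measurable A -> (N A <= K%:E * arc_length R A)%E) ->
  N `<< arc_length R /\
  exists2 f : Circ -> R,
    f \in Lfun (arc_length R) +oo%E &
    forall A, measurable A -> N A = (\int[arc_length R]_(x in A) (f x)%:E)%E.
Proof.
move=> NK.
have dom : N `<< arc_length R.
  apply/null_content_dominatesP => A mA A0; apply/eqP.
  by rewrite eq_le measure_ge0 andbT (le_trans (NK _ mA))// A0 mule0.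
split => //.
have [g [g0 gfin gint gE]] := @radon_nikodym_sigma_finite _ _ _ (arc_length R) N dom.
have gf x : (fine (g x))%:E = g x by rewrite fineK.
have mg : measurable_fun setT g by exact: measurable_int gint.
pose S := [set x | K%:E < g x]%E.
have mS : measurable S.
  rewrite -[S]setTI; exact: emeasurable_fun_o_infty.
exists (fine \o g); last first.
  by move=> A mA; rewrite gE//; apply: eq_integral => x _ /=; rewrite gf.
have gK : {ae arc_length R, forall x, (g x <= K%:E)%E}.
  have iK : (arc_length R).-integrable S (cst K%:E).
    exact: finite_measure_integrable_cst.
  have ig : (arc_length R).-integrable S g by exact: integrableS gint.
  have gK0 x : S x -> (0 <= g x - K%:E)%E by move=> h; rewrite suber_ge0 ?ltW.
  have : (\int[arc_length R]_(x in S) `|g x - K%:E| = 0)%E.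
    apply/eqP; rewrite eq_le integral_ge0 ?andbT//.
    under eq_integral => x /set_mem Sx do rewrite gee0_abs ?gK0//.
    rewrite integralB// -gE// integral_cst// sube_le0; exact: NK.
  move/(ae_eq_integral_abs (arc_length R) mS (measurable_int _ (integrableB mS ig iK))).
  apply: filterS => x /= h; rewrite leNgt; apply/negP => Sx.
  move: (h Sx) (Sx); rewrite -gf -EFinD lte_fin => -[]; lra.
rewrite inE; apply/andP; split.
  by rewrite inE; exact: measurableT_comp.
rewrite inE /= /finite_norm unlock /=; case: ifP => // _.
apply: (@le_lt_trans _ _ K%:E); last exact: ltry.
apply/ess_supP; apply: filterS gK => x; rewrite /= -{1}gf !lee_fin => h.
by rewrite ger0_norm// fine_ge0.
Qed.

End clark.

Unset Implicit Arguments.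

Theorem corollary1 (R : realType) (t kappa : R)
    (t_gt0 : 0 < t) (kappa_itv : -1 < kappa < 1) (kappa_neq0 : kappa != 0)
    (N : probability (Borel_circle R) R)
    (N_Clark : is_Clark_measure_at_1 (psi_inv kappa t) N) :
  N `<< arc_length R /\
  exists2 f : Borel_circle R -> R,
    f \in Lfun (arc_length R) +oo%E &
    forall A, measurable A -> N A = (\int[arc_length R]_(x in A) (f x)%:E)%E.
Proof.
pose C := Re_bound t kappa + 1.
apply: (@bounded_density _ N (4 * C)); apply: clark_le_arc_length N_Clark _ _.
- by rewrite lerDr divr_ge0 ?sqrtr_ge0// addr_ge0// divr_ge0// ltW.
- exact: Re_H0_psi_inv.
Qed.
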